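(* Let $\varepsilon,\varepsilon_T\ge 0$ and let $v_\psi\in\mathcal V_\Psi\subset C^1([t_0,T]\times X)$ be $(\varepsilon,\varepsilon_T)$-feasible. Then, for every trial parameter $\theta$ from any finite-dimensional realization class $\Theta^{(M)}$, with induced primal pair $(\mu_\theta,\mu_{T,\theta})\in\mathcal M_+(Z)\times\mathcal M_+(\{T\}\times X)$, $$J(\theta)=\langle v_\psi,\mu_0\rangle+\langle s_\psi,\mu_\theta\rangle+\langle s_{T,\psi},\mu_{T,\theta}\rangle+\mathcal R_\theta(v_\psi),$$ hence $$\underline J(\theta,\psi)\le J(\theta),$$ and $$\mathrm{Gap}(\theta,\psi)=\langle s_\psi+\varepsilon,\mu_\theta\rangle+\langle s_{T,\psi}+\varepsilon_T,\mu_{T,\theta}\rangle+2[\mathcal R_\theta(v_\psi)]_+\ \ge\ 0,$$ where $[a]_+:=\max\{a,0\}$.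
   Context: Setting. Let $t_0<T$, $X\subseteq\mathbb R^n$ (states), $U\subseteq\mathbb R^m$ (controls), $Z:=[t_0,T]\times X\times U$, with dynamics $f:Z\to\mathbb R^n$, running cost $\ell:Z\to\mathbb R$, terminal cost $g:X\to\mathbb R$. $\mathcal M_+(\cdot)$ denotes finite nonnegative Borel measures and $\langle\phi,\rho\rangle:=\int\phi\,d\rho$. A fixed initial measure $\mu_0\in\mathcal M_+(\{t_0\}\times X)$ is given. Measures on $\{t_0\}\times X$ or $\{T\}\times X$ are identified with measures on $X$, so $\langle v,\mu_0\rangle=\int v(t_0,x)\,\mu_0(dx)$ and $\langle v,\mu_T\rangle=\int v(T,x)\,\mu_T(dx)$. For $v\in C^1([t_0,T]\times X)$, $(L_fv)(t,x,u):=\partial_tv(t,x)+\nabla_xv(t,x)^\top f(t,x,u)$. All pairings appearing are assumed well-defined and finite. Trial realization: $\Theta^{(M)}$ is a set of finite-dimensional parameters $\theta$, together with a map $\theta\mapsto(\mu_\theta,\mu_{T,\theta})\in\mathcal M_+(Z)\times\mathcal M_+(\{T\}\times X)$ (the induced pair need not satisfy any dynamics constraint). The realized cost is $J(\theta):=\langle\ell,\mu_\theta\rangle+\langle g,\mu_{T,\theta}\rangle$. The Liouville residual is $\mathcal R_\theta(v):=\langle v,\mu_{T,\theta}-\mu_0\rangle-\langle L_fv,\mu_\theta\rangle$. Certificates: $\mathcal V_\Psi=\{v_\psi:\psi\in\Psi\}\subset C^1([t_0,T]\times X)$ is a parameterized family. Slacks: $s_\psi(t,x,u):=\ell(t,x,u)+(L_fv_\psi)(t,x,u)$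 and $s_{T,\psi}(x):=g(x)-v_\psi(T,x)$. $v_\psi$ is $(\varepsilon,\varepsilon_T)$-feasible if $s_\psi\ge-\varepsilon$ on $Z$ and $s_{T,\psi}\ge-\varepsilon_T$ on $X$. Residual-corrected lower bound and gap: $$\underline J(\theta,\psi):=\langle v_\psi,\mu_0\rangle-\varepsilon\,\mu_\theta(Z)-\varepsilon_T\,\mu_{T,\theta}(X)-|\mathcal R_\theta(v_\psi)|,\qquad \mathrm{Gap}(\theta,\psi):=J(\theta)-\underline J(\theta,\psi).$$ *)

(* Defs.v *)
From HB Require Import structures.
From mathcomp Require Import all_boot all_order all_algebra.
From mathcomp Require Import all_classical all_reals all_analysis.

Set Implicit Arguments.
Unset Strict Implicit.
Unset Printing Implicit Defensive.

Import Order.TTheory GRing.Theory Num.Theory.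
Import numFieldNormedType.Exports.

Local Open Scope classical_set_scope.
Local Open Scope ring_scope.

Notation borel T := (g_sigma_algebraType (@open T)).

(* M_+(A), for an arbitrary subset A of T. A set is open in [subspace A] iff
   its trace on A is open in A, so the measurable subsets of A are the Borel
   sets of the topological space A, whether or not A is Borel in T, and every
   subset of the complement of A is measurable; such a subset gets mass 0. *)
Record fborel_measure (R : realType) (T : normedModType R) (A : set T) :=
  FBorelMeasure {
    fbm_measure :> {finite_measure set (borel (subspace A)) -> \bar R} ;
    fbm_supported : fbm_measure (~` A) = 0%E }.

Definition pairing (R : realType) (T : normedModType R) (A : set T)
    (phi : T -> R) (rho : fborel_measure A) : R :=
  (\int[rho]_(x in A) phi x)%R.

Definition pairing_finite (R : realType) (T : normedModType R) (A : set T)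
    (phi : T -> R) (rho : fborel_measure A) : Prop :=
  (fbm_measure rho).-integrable A (EFin \o phi).

Definition mass (R : realType) (T : normedModType R) (A : set T)
    (rho : fborel_measure A) : R := fine (rho A).

(* C^1(D) for a set D that need not be open: v is C^1 on an open neighbourhood
   of D. An element of C^1(D) is thus given by such an extension, from which
   its derivatives on D are taken. In finite dimension, continuity of all
   directional derivatives is continuity of the differential. *)
Definition C1_on (R : realType) (V : normedModType R) (D : set V)
    (v : V -> R) : Prop :=
  exists O : set V, [/\ open O, D `<=` O,
    forall y, O y -> differentiable v y &
    forall h y, O y -> {for y, continuous (fun z => 'D_h v z)}].

Definition dtime (R : realType) (n : nat) (v : R * 'rV[R]_n -> R)
    (t : R) (x : 'rV[R]_n) : R := derive1 (fun s : R => v (s, x)) t.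

Definition grad (R : realType) (n : nat) (v : R * 'rV[R]_n -> R)
    (t : R) (x : 'rV[R]_n) : 'rV[R]_n :=
  \row_(i < n) 'D_(delta_mx ord0 i) (fun y : 'rV[R]_n => v (t, y)) x.

(* The functions [dyn], [run_cost] and [term_cost] are total, but only their
   values on Z, Z and X are ever used. A measure on {t0} * X (or on {T} * X)
   is identified with a measure on X. *)
Record control_problem (R : realType) (n m : nat) := ControlProblem {
  t_init : R ;
  t_end : R ;
  t_init_lt_end : t_init < t_end ;
  states : set 'rV[R]_n ;
  controls : set 'rV[R]_m ;
  dyn : R * 'rV[R]_n * 'rV[R]_m -> 'rV[R]_n ;
  run_cost : R * 'rV[R]_n * 'rV[R]_m -> R ;
  term_cost : 'rV[R]_n -> R ;
  mu_init : fborel_measure states }.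

Section problem.
Context {R : realType} {n m : nat} (P : control_problem R n m).
Implicit Types (v : R * 'rV[R]_n -> R) (z : R * 'rV[R]_n * 'rV[R]_m).

Definition time_states : set (R * 'rV[R]_n) :=
  `[t_init P, t_end P] `*` states P.

Definition admissible : set (R * 'rV[R]_n * 'rV[R]_m) :=
  time_states `*` controls P.

Definition liouville_op v z : R :=
  dtime v z.1.1 z.1.2 +
  \sum_(i < n) grad v z.1.1 z.1.2 ord0 i * dyn P z ord0 i.

Record trial_realization := TrialRealization {
  param_dim : nat ;
  params : set 'rV[R]_param_dim ;
  mu_trial : 'rV[R]_param_dim -> fborel_measure admissible ;
  muT_trial : 'rV[R]_param_dim -> fborel_measure (states P) }.

Record certificate_family := CertificateFamily {
  cert_index : Type ;
  cert : cert_index -> R * 'rV[R]_n -> R ;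
  cert_C1 : forall psi, C1_on time_states (cert psi) }.

Definition slack v z : R := run_cost P z + liouville_op v z.

Definition term_slack v (x : 'rV[R]_n) : R := term_cost P x - v (t_end P, x).

Definition feasible (eps epsT : R) v : Prop :=
  (forall z, admissible z -> - eps <= slack v z) /\
  (forall x, states P x -> - epsT <= term_slack v x).

Section trial.
Variables (F : trial_realization) (V : certificate_family).
Implicit Types (theta : 'rV[R]_(param_dim F)) (psi : cert_index V).

Definition realized_cost theta : R :=
  pairing (run_cost P) (mu_trial theta) +
  pairing (term_cost P) (muT_trial theta).

Definition residual theta v : R :=
  (pairing (fun x => v (t_end P, x)) (muT_trial theta) -
   pairing (fun x => v (t_init P, x)) (mu_init P)) -
  pairing (liouville_op v) (mu_trial theta).

Definition pairings_finite theta v : Prop :=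
  [/\ pairing_finite (run_cost P) (mu_trial theta),
      pairing_finite (term_cost P) (muT_trial theta),
      pairing_finite (liouville_op v) (mu_trial theta),
      pairing_finite (fun x => v (t_end P, x)) (muT_trial theta) &
      pairing_finite (fun x => v (t_init P, x)) (mu_init P)].

Definition lower_bound (eps epsT : R) theta psi : R :=
  pairing (fun x => cert psi (t_init P, x)) (mu_init P) -
  eps * mass (mu_trial theta) - epsT * mass (muT_trial theta) -
  `|residual theta (cert psi)|.

Definition gap (eps epsT : R) theta psi : R :=
  realized_cost theta - lower_bound eps epsT theta psi.

End trial.
End problem.

(* Main.v *)
Require Import Defs.
From HB Require Import structures.
From mathcomp Require Import all_boot all_order all_algebra.
From mathcomp Require Import all_classical all_reals all_analysis.
From mathcomp Require Import ring.

Import Order.TTheory GRing.Theory Num.Theory.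
Import numFieldNormedType.Exports.
Local Open Scope classical_set_scope.
Local Open Scope ring_scope.

(** The statement is linear bookkeeping. Adding the pairings of the two slacks to the residual, the
    Liouville term and the terminal value of the certificate each occur twice with opposite signs,
    and what survives is the cost minus the initial value of the certificate; the trial measures
    need not satisfy the dynamics. Subtracting the lower bound adds the mass penalties, which
    [pairing_addc] absorbs as constant shifts of the slacks, and leaves the residual plus its
    absolute value, that is, twice its positive part. By feasibility the shifted slacks are
    nonnegative, so by [pairing_ge0] the gap is too. *)

Section pairing.
Context {R : realType} {T : normedModType R} {A : set T}.
Variable rho : fborel_measure A.
Implicit Types phi psi : T -> R.

(* [A] is measurable even when it is not Borel in [T]: it is open in
   [subspace A]. *)
Lemma measurable_carrier : measurable (A : set (borel (subspace A))).
Proof. by apply: sub_sigma_algebra; exact: open_subspaceT. Qed.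

Lemma pairing_finiteD phi psi :
  pairing_finite phi rho -> pairing_finite psi rho ->
  pairing_finite (fun x => phi x + psi x) rho.
Proof. move=> fphi fpsi; exact: (integrableD measurable_carrier fphi fpsi). Qed.

Lemma pairing_finiteB phi psi :
  pairing_finite phi rho -> pairing_finite psi rho ->
  pairing_finite (fun x => phi x - psi x) rho.
Proof. move=> fphi fpsi; exact: (integrableB measurable_carrier fphi fpsi). Qed.

Lemma pairingD phi psi :
  pairing_finite phi rho -> pairing_finite psi rho ->
  pairing (fun x => phi x + psi x) rho = pairing phi rho + pairing psi rho.
Proof. move=> fphi fpsi; exact: (RintegralD measurable_carrier fphi fpsi). Qed.

Lemma pairingB phi psi :
  pairing_finite phi rho -> pairing_finite psi rho ->
  pairing (fun x => phi x - psi x) rho = pairing phi rho - pairing psi rho.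
Proof. move=> fphi fpsi; exact: (RintegralB measurable_carrier fphi fpsi). Qed.

(** Constants are integrable because [rho] is finite, and integrating one over [A] yields the
    mass. *)
Lemma pairing_addc phi (c : R) : pairing_finite phi rho ->
  pairing (fun x => phi x + c) rho = pairing phi rho + c * mass rho.
Proof.
move=> phi_fin.
have c_fin : pairing_finite (fun=> c) rho.
  exact: (finite_measure_integrable_cst _ c measurable_carrier).
rewrite (pairingD _ _ phi_fin c_fin); congr (_ + _).
exact: (Rintegral_cst _ measurable_carrier c).
Qed.

Lemma pairing_ge0 phi :
  (forall x, A x -> 0 <= phi x) -> 0 <= pairing phi rho.
Proof. by move=> phi_ge0; apply: (Rintegral_ge0 rho). Qed.

End pairing.

Theorem proposition2 (R : realType) (n m : nat) (P : control_problem R n m)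
    (V : certificate_family P) (psi : cert_index V) (eps epsT : R)
    (eps_ge0 : 0 <= eps) (epsT_ge0 : 0 <= epsT)
    (psi_feasible : feasible P eps epsT (cert psi))
    (F : trial_realization P) (theta : 'rV[R]_(param_dim F))
    (theta_param : params theta)
    (finite_pairings : pairings_finite theta (cert psi)) :
  [/\ realized_cost theta =
        pairing (fun x => cert psi (t_init P, x)) (mu_init P) +
        pairing (slack P (cert psi)) (mu_trial theta) +
        pairing (term_slack P (cert psi)) (muT_trial theta) +
        residual theta (cert psi),
      lower_bound eps epsT theta psi <= realized_cost theta,
      gap eps epsT theta psi =
        pairing (fun z => slack P (cert psi) z + eps) (mu_trial theta) +
        pairing (fun x => term_slack P (cert psi) x + epsT)
          (muT_trial theta) +
        2 * Num.max (residual theta (cert psi)) 0 &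
      0 <= gap eps epsT theta psi].
Proof.
case: finite_pairings => run_fin term_fin liou_fin vT_fin _.
case: psi_feasible => slack_ge slackT_ge.
(* [slack] and [term_slack] unfold to this sum and this difference, so these equations rewrite
   pairings of slacks. *)
have slackE := pairingD _ _ _ run_fin liou_fin.
have slackTE := pairingB _ _ _ term_fin vT_fin.
have slackcE := pairing_addc _ _ eps (pairing_finiteD _ _ _ run_fin liou_fin).
have slackTcE := pairing_addc _ _ epsT (pairing_finiteB _ _ _ term_fin vT_fin).
(* Feasibility speaks only of points of [admissible] and [states P]; this suffices, as the pairings
   integrate over just these sets. *)
have slackc_ge0 :
    0 <= pairing (fun z => slack P (cert psi) z + eps) (mu_trial theta).
  by apply: pairing_ge0 => z /slack_ge; rewrite -subr_ge0 opprK.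
have slackTc_ge0 :
    0 <= pairing (fun x => term_slack P (cert psi) x + epsT) (muT_trial theta).
  by apply: pairing_ge0 => x /slackT_ge; rewrite -subr_ge0 opprK.
have decomposition : realized_cost theta =
    pairing (fun x => cert psi (t_init P, x)) (mu_init P) +
    pairing (slack P (cert psi)) (mu_trial theta) +
    pairing (term_slack P (cert psi)) (muT_trial theta) +
    residual theta (cert psi).
  by rewrite /realized_cost /residual slackE slackTE; ring.
(* Source of the factor 2: the residual enters the gap once signed, through [decomposition], and
   once in absolute value, through [lower_bound]. *)
have abs_maxE (a : R) : a + `|a| = 2 * Num.max a 0.
  by case: (lerP 0 a) => [/ger0_norm|/ltr0_norm] ->; ring.
have gapE : gap eps epsT theta psi =
    pairing (fun z => slack P (cert psi) z + eps) (mu_trial theta) +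
    pairing (fun x => term_slack P (cert psi) x + epsT) (muT_trial theta) +
    2 * Num.max (residual theta (cert psi)) 0.
  by rewrite /gap /lower_bound decomposition slackcE slackTcE -abs_maxE; ring.
have gap_ge0 : 0 <= gap eps epsT theta psi.
  by rewrite gapE !addr_ge0 // mulr_ge0 // le_max lexx orbT.
(* The lower bound is [gap_ge0] read backwards, since [gap] is by definition the difference of its
   two sides. *)
by split=> //; rewrite -subr_ge0.
Qed.
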